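(* Let $i\ge 0$ and $d\ge -i$ be integers, let $T:D(T)\subset \ell^2(\mathbb{Z}_{\ge 0})\to \ell^2(\mathbb{Z}_{\ge 0})$ be a tridiagonal operator with coefficients $\{l_n\}_{n\ge 0},\{d_n\}_{n\ge 0},\{u_n\}_{n\ge 0}$ and let $T=L+D+U$ be its $LDU$-decomposition. Then for every integer $m\ge 0$ $$ \langle e_{i+d}, T^m e_i\rangle= \begin{cases} \sum_{\omega} v(\omega)&\text{if } d=0,\\ l_i l_{i+1}\cdots l_{i+d-1}\sum_{\omega} v(\omega)&\text{if } d>0,\\ u_{i-1}u_{i-2}\cdots u_{i+d}\sum_{\omega} v(\omega)&\text{if } d<0. \end{cases} $$ Here $\sum_{\omega} v(\omega)$ is the total weight of all weighted Motzkin paths of length $m$ starting at $(0,i)$ and ending at $(m,i+d)$ such that each northeast step has weight $1$, each southeast step starting at level $n$ has weight $\lambda_n=l_{n-1}u_{n-1}$, and each east step at level $n$ has weight $d_n$. In particular, if $D$ is identically zero, then $\sum_{\omega} v(\omega)$ is the total weight of all weighted Dyck paths of length $m$ starting at $(0,i)$ and ending at $(m,i+d)$ such that each northeast step has weight $1$ and each southeast step starting at level $n$ has weight $\lambda_n=l_{n-1}u_{n-1}$.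
   Context: $\ell^2(\mathbb{Z}_{\ge 0})$ is the complex Hilbert space with orthonormal basis $e_0,e_1,e_2,\ldots$. A tridiagonal operator is a linear operator $T:D(T)\subset \ell^2(\mathbb{Z}_{\ge 0})\to\ell^2(\mathbb{Z}_{\ge 0})$, defined on at least the linear span of $\{e_0,e_1,\ldots\}$, for which there are real numbers $\{l_n\}_{n\ge 0},\{d_n\}_{n\ge 0},\{u_n\}_{n\ge 0}$ with $Te_0=d_0e_0+l_0e_1$ and $Te_n=u_{n-1}e_{n-1}+d_ne_n+l_ne_{n+1}$ for $n\ge 1$. Its $LDU$-decomposition is $T=L+D+U$, where $Le_n=l_ne_{n+1}$, $De_n=d_ne_n$, $Ue_{n+1}=u_ne_n$ for $n\ge 0$ and $Ue_0=0$. A Motzkin path of length $m$ is a lattice path $(s_0,\ldots,s_m)$ in $\mathbb{Z}\times\mathbb{Z}$ all of whose points have non-negative second coordinate and each of whose steps is a northeast step $(1,1)$, an east step $(1,0)$ or a southeast step $(1,-1)$. The level of a lattice point is its second coordinate. A Dyck path is a Motzkin path with no east steps. The weight $v(\omega)$ of a path $\omega$ is the product of the weights of its steps.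
   Formalization: For d<0 the formula as printed is false (i=m=1, d=-1, u_0=1, l_0=2: left side 1, right side 2); the formal version keeps the prefactor and weights but sums over Motzkin paths from (0,i+d) to (m,i), with endpoints exchanged. *)

(* Defs.v *)
From HB Require Import structures.
From mathcomp Require Import all_boot all_order all_algebra.
From mathcomp Require Import all_classical all_reals all_analysis.
From mathcomp Require Import complex lra.

Set Implicit Arguments.
Unset Strict Implicit.
Unset Printing Implicit Defensive.

Import Order.TTheory GRing.Theory Num.Theory.
Import numFieldNormedType.Exports.

Local Open Scope classical_set_scope.
Local Open Scope ring_scope.
Local Open Scope complex_scope.

(* The regular module [R[i]^o], rather than [R[i]], carries the scalar
   multiplication and the topology of the complex plane. *)
Definition square_summable (R : realType) (x : nat -> R[i]^o) : Prop :=
  cvgn (series (fun k => ComplexField.Normc.normc (x k) ^+ 2 : R)).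

Definition ell2_pred (R : realType) : {pred (nat -> R[i]^o)} :=
  fun x => `[< square_summable x >].

Record ell2 (R : realType) :=
  Ell2 { coords :> nat -> R[i]^o; _ : coords \in @ell2_pred R }.

HB.instance Definition _ (R : realType) := [isSub for @coords R].
HB.instance Definition _ (R : realType) := [Choice of ell2 R by <:].

Lemma normc_lin_sqr (R : realType) (a z w : R[i]) :
  ComplexField.Normc.normc (a * z + w) ^+ 2 <=
  2 * ComplexField.Normc.normc a ^+ 2 * ComplexField.Normc.normc z ^+ 2
  + 2 * ComplexField.Normc.normc w ^+ 2 :> R.
Proof.
have h : ComplexField.Normc.normc (a * z + w) <=
    ComplexField.Normc.normc a * ComplexField.Normc.normc z
    + ComplexField.Normc.normc w.
  by rewrite -ComplexField.Normc.normcM; exact: le_normcD.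
have n0 (v : R[i]) : 0 <= ComplexField.Normc.normc v.
  by case: v => p q; exact: sqrtr_ge0.
apply: (@le_trans _ _ ((ComplexField.Normc.normc a * ComplexField.Normc.normc z
    + ComplexField.Normc.normc w) ^+ 2)).
  by rewrite ler_sqr// nnegrE ?addr_ge0 ?mulr_ge0.
rewrite -mulrA -exprMn.
move: (_ * _ : R) (ComplexField.Normc.normc w : R) => p q.
rewrite -subr_ge0 (_ : _ - _ = (p - q) ^+ 2) ?sqr_ge0//.
rewrite sqrrB sqrrD !mulr_natl !mulr2n; lra.
Qed.

Lemma ell2_submod_closed (R : realType) : submod_closed (@ell2_pred R).
Proof.
split.
  apply/asboolP; rewrite /square_summable.
  rewrite (_ : (fun k => _) = (fun=> 0)); last first.
    by apply/funext => k; rewrite ComplexField.Normc.normc0 expr0n.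
  rewrite /series /=; apply/cvg_ex; exists 0.
  by under eq_fun do rewrite big1//; exact: cvg_cst.
move=> a x y /asboolP xs /asboolP ys; apply/asboolP.
apply: (series_le_cvg (v_ := fun k =>
   2 * ComplexField.Normc.normc a ^+ 2 * ComplexField.Normc.normc (x k) ^+ 2
  + 2 * ComplexField.Normc.normc (y k) ^+ 2)).
- by move=> n; exact: sqr_ge0.
- move=> n; apply: addr_ge0; last by apply: mulr_ge0; [|exact: sqr_ge0].
  by apply: mulr_ge0; [apply: mulr_ge0; [|exact: sqr_ge0]|exact: sqr_ge0].
- by move=> n; exact: normc_lin_sqr.
- have cZ (c : R) f : cvgn (series f) -> cvgn (series (fun k => c * f k)).
    exact: is_cvg_seriesZ.
  by apply: is_cvg_seriesD; apply: cZ.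
Qed.

HB.instance Definition _ (R : realType) :=
  GRing.isSubmodClosed.Build R[i] (nat -> R[i]^o) (@ell2_pred R)
    (@ell2_submod_closed R).
HB.instance Definition _ (R : realType) :=
  [SubChoice_isSubLmodule of ell2 R by <:].

(* Antilinear in the first argument. *)
Definition inner (R : realType) (x y : ell2 R) : R[i] :=
  limn (series (fun k => conjc (x k) * y k : R[i]^o)).

Lemma delta_ell2 (R : realType) (n : nat) :
  (fun k => (k == n)%:R : R[i]^o) \in @ell2_pred R.
Proof.
apply/asboolP/(nondecreasing_is_cvgn (nondecreasing_series _)).
  by move=> k _ _; exact: sqr_ge0.
exists 1 => _ [N _ <-]; rewrite /series /= big_mkord.
have E k : ComplexField.Normc.normc ((k == n)%:R : R[i]) ^+ 2 = (k == n)%:R :> R.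
  by case: (k == n); rewrite ?ComplexField.Normc.normc0
    ?ComplexField.Normc.normc1 ?expr0n ?expr1n.
under eq_bigr do rewrite E.
have [nN|Nn] := ltnP n N.
  rewrite (bigD1 (Ordinal nN))//= eqxx big1 ?addr0// => k.
  by rewrite -val_eqE /= => /negbTE ->.
by rewrite big1 ?ler01// => k _; rewrite ltn_eqF// (leq_trans (ltn_ord k)).
Qed.

Definition e (R : realType) (n : nat) : ell2 R := Ell2 (delta_ell2 R n).

Definition e_span (R : realType) : set (ell2 R) :=
  [set x | exists N (c : 'I_N -> R[i]), x = \sum_(k < N) c k *: e R k].

(* A linear operator D(T) -> ell2 defined on a subspace D(T) of ell2; the values
   of [app] outside [dom] are irrelevant. *)
Record operator (R : realType) := Operator {
  dom : set (ell2 R);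
  app :> ell2 R -> ell2 R;
  dom0 : dom 0;
  domP : forall (a : R[i]) x y, dom x -> dom y -> dom (a *: x + y);
  appP : forall (a : R[i]) x y, dom x -> dom y ->
    app (a *: x + y) = a *: app x + app y }.

Lemma app0 (R : realType) (T : operator R) : T 0 = 0.
Proof.
have := appP (-1) (dom0 T) (dom0 T).
by rewrite scaler0 addr0 scaleN1r addNr.
Qed.

Definition op_id (R : realType) : operator R.
Proof. by exists setT id. Defined.

Definition op_comp (R : realType) (S T : operator R) : operator R.
Proof.
exists [set x | dom T x /\ dom S (T x)] (S \o T).
- by split; [exact: dom0 | rewrite app0; exact: dom0].
- move=> a x y [Tx STx] [Ty STy]; split; first exact: domP.
  by rewrite appP//; exact: domP.
- by move=> a x y [Tx STx] [Ty STy] /=; rewrite !appP.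
Defined.

Fixpoint op_pow (R : realType) (T : operator R) (m : nat) : operator R :=
  if m is m'.+1 then op_comp T (op_pow T m') else op_id R.

Definition tridiagonal (R : realType) (T : operator R) (l d u : nat -> R) : Prop :=
  [/\ @e_span R `<=` dom T,
      T (e R 0) = (d 0)%:C *: e R 0 + (l 0)%:C *: e R 1 &
      forall n, (1 <= n)%N ->
        T (e R n) = (u n.-1)%:C *: e R n.-1 + (d n)%:C *: e R n
                    + (l n)%:C *: e R n.+1].

Record LDU_decomposition (R : realType) (T : operator R) (l d u : nat -> R)
    (L D U : operator R) : Prop := {
  LDU_domL : @e_span R `<=` dom L;
  LDU_domD : @e_span R `<=` dom D;
  LDU_domU : @e_span R `<=` dom U;
  LDU_L : forall n, L (e R n) = (l n)%:C *: e R n.+1;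
  LDU_D : forall n, D (e R n) = (d n)%:C *: e R n;
  LDU_U0 : U (e R 0) = 0;
  LDU_US : forall n, U (e R n.+1) = (u n)%:C *: e R n;
  LDU_T : forall x, e_span x -> T x = L x + D x + U x }.

Definition identically_zero (R : realType) (T : operator R) : Prop :=
  forall x, dom T x -> T x = 0.

Definition point := (int * int)%type.

Definition level (p : point) : nat := `|p.2|%N.

Definition northeast (p q : point) := q == (p.1 + 1, p.2 + 1).
Definition east (p q : point) := q == (p.1 + 1, p.2).
Definition southeast (p q : point) := q == (p.1 + 1, p.2 - 1).

(* A path is the sequence of its points s_0, ..., s_m; its length m is the number
   of its steps. *)
Definition steps (s : seq point) : seq (point * point) := zip s (behead s).

Definition motzkin (s : seq point) : bool :=
  all (fun p => 0 <= p.2) s &&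
  all (fun st => [|| northeast st.1 st.2, east st.1 st.2 | southeast st.1 st.2])
    (steps s).

Definition dyck (s : seq point) : bool :=
  motzkin s && all (fun st => ~~ east st.1 st.2) (steps s).

Definition joins (m a b : nat) (s : seq point) : bool :=
  [&& size s == m.+1, head (0, 0) s == (0, a%:Z) & last (0, 0) s == (m%:Z, b%:Z)].

(* Used only at starting levels n >= 1 of southeast steps. *)
Definition lambda (R : realType) (l u : nat -> R) (n : nat) : R :=
  l n.-1 * u n.-1.

Definition motzkin_step_weight (R : realType) (l d u : nat -> R)
    (p q : point) : R :=
  if northeast p q then 1 else if east p q then d (level p)
  else lambda l u (level p).

Definition dyck_step_weight (R : realType) (l u : nat -> R) (p q : point) : R :=
  if northeast p q then 1 else lambda l u (level p).

Definition weight (R : realType) (w : point -> point -> R) (s : seq point) : R :=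
  \prod_(st <- steps s) w st.1 st.2.

(* [\sum_(s \in A)] is 0 by convention when infinitely many terms are nonzero;
   the sets of paths below are finite, so this convention never applies. *)
Definition motzkin_total (R : realType) (l d u : nat -> R) (m a b : nat) : R :=
  \sum_(s \in [set s | motzkin s && joins m a b s])
    weight (motzkin_step_weight l d u) s.

Definition dyck_total (R : realType) (l u : nat -> R) (m a b : nat) : R :=
  \sum_(s \in [set s | dyck s && joins m a b s])
    weight (dyck_step_weight l u) s.

(* Main.v *)
Require Import Defs.
From mathcomp Require Import all_boot all_order all_algebra.
From mathcomp Require Import all_classical all_reals all_analysis.
From mathcomp Require Import complex ring zify.

Import Order.TTheory GRing.Theory Num.Theory.
Local Open Scope ring_scope.
Local Open Scope complex_scope.

(** Let N(m, a, b) be the total weight of the Motzkin paths of length m from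
    level a to level b.  Removing the last step of a path gives
      N(m+1, a, b) = N(m, a, b-1) + d_b N(m, a, b) + lambda_(b+1) N(m, a, b+1),
    that is, N(m, -, -) is the m-th power of the tridiagonal matrix with
    superdiagonal 1, diagonal d and subdiagonal lambda.  Hence N also satisfies
    the recurrence obtained by removing the first step
    ([path_weight_first]), and reversing paths gives
      N(m, b, a) = lambda_(a+1) ... lambda_b N(m, a, b)   for a <= b
    ([path_weight_rev]).

    On the other side, a tridiagonal operator T maps finitely supported vectors
    to finitely supported vectors, with
      (T x)_n = u_n x_(n+1) + d_n x_n + l_(n-1) x_(n-1)
    ([tridiagonal_coord]), so the coordinates of T^m e_i satisfy a three-term
    recurrence in m.  By induction on m, the coordinate at j is
    l_i ... l_(j-1) N(m, i, j) if i <= j, and u_j ... u_(i-1) N(m, j, i) if j < i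
    ([op_pow_coord]): above i this is the last-step recurrence, since
    lambda_(j+1) = l_j u_j; below i it is the first-step recurrence; at j = i the
    coordinate at i - 1 enters through N(m, i-1, i), which reversal turns into
    the term N(m, i, i-1) of the last-step recurrence.

    The sum over the set of all Motzkin paths is identified with N by
    a duplicate-free enumeration of the paths ([motzkin_totalE]).  If D = 0 then
    every d_n is 0, so that the paths with an east step contribute nothing. *)

(** * Total weights of Motzkin paths as powers of a tridiagonal matrix *)

(** [path_weight lam d m a b] is the entry (a, b) of the m-th power of the
    infinite tridiagonal matrix with entries 1 at (n, n+1), [d n] at (n, n) and
    [lam n] at (n, n-1), defined by multiplication on the right. It is the total
    weight of the Motzkin paths of length m from level a to level b. *)
Fixpoint path_weight {R : comNzRingType} (lam d : nat -> R) (m a b : nat) : R :=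
  if m is m'.+1 then
    (if b is b'.+1 then path_weight lam d m' a b' else 0)
    + path_weight lam d m' a b * d b
    + path_weight lam d m' a b.+1 * lam b.+1
  else (a == b)%:R.

Lemma path_weight_last (R : comNzRingType) (lam d : nat -> R) (m a b : nat) :
  path_weight lam d m.+1 a b =
  (if b is b'.+1 then path_weight lam d m a b' else 0)
  + path_weight lam d m a b * d b
  + path_weight lam d m a b.+1 * lam b.+1.
Proof. by []. Qed.

Lemma natr_eq_mulr (R : comNzRingType) (x y : nat) (f : nat -> R) :
  (x == y)%:R * f y = f x * (x == y)%:R.
Proof. by case: eqP => [->|_]; rewrite ?mul0r ?mulr0 // mulrC. Qed.

Lemma path_weight_first (R : comNzRingType) (lam d : nat -> R) (m a b : nat) :
  path_weight lam d m.+1 a b =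
  path_weight lam d m a.+1 b
  + d a * path_weight lam d m a b
  + (if a is a'.+1 then lam a * path_weight lam d m a' b else 0).
Proof.
elim: m a b => [|m IH] a b; last first.
  rewrite [LHS]path_weight_last.
  case: a => [|a]; case: b => [|b]; rewrite ![in LHS]IH !(path_weight_last _ _ _ m); ring.
case: a => [|a]; case: b => [|b] /=; last first.
  by rewrite !eqSS (natr_eq_mulr _ _ _ (d \o succn)) (natr_eq_mulr _ _ _ (lam \o succn)).
all: by rewrite ?eqSS ?(natr_eq_mulr _ _ _ (lam \o succn)) ?mul0r ?mulr0 ?mul1r ?mulr1.
Qed.

(** Reversing a path exchanges northeast and southeast steps; for each level k
    with a <= k < b, a path from b to a crosses from k+1 down to k once more
    than it crosses back, whence the factor [lam k.+1]. *)
Lemma path_weight_rev (R : comNzRingType) (lam d : nat -> R) (m a b : nat) :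
  (a <= b)%N ->
  path_weight lam d m b a =
  (\prod_(a <= k < b) lam k.+1) * path_weight lam d m a b.
Proof.
elim: m a b => [|m IH] a b; rewrite leq_eqVlt => /predU1P[<-|ab];
  try by rewrite big_geq// mul1r.
  by rewrite /= gtn_eqF// ltn_eqF// mulr0.
rewrite path_weight_first path_weight_last.
case: b ab => // b; rewrite ltnS => ab.
rewrite (IH a b) ?(IH a b.+1) ?(IH a b.+2) ?leqW ?ab// (big_nat_recr b.+1 a)/= ?leqW//.
rewrite (big_nat_recr b a)//=; ring.
Qed.

(** * Tridiagonal operators on finitely supported vectors *)

Section Coordinates.
Context {R : realType}.
Implicit Types (x y : ell2 R).

Lemma ell2P x y : (forall n, x n = y n) -> x = y.
Proof. by move=> xy; apply/val_inj/funext. Qed.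

Lemma coordsD x y n : (x + y) n = x n + y n.
Proof. by []. Qed.

Lemma coordsZ (a : R[i]) x n : (a *: x) n = a * x n.
Proof. by []. Qed.

Lemma coords0 n : (0 : ell2 R) n = 0.
Proof. by []. Qed.

Lemma coords_sum (I : Type) (r : seq I) (P : pred I) (F : I -> ell2 R) n :
  (\sum_(k <- r | P k) F k) n = \sum_(k <- r | P k) F k n.
Proof. exact: (big_morph (fun x : ell2 R => x n)). Qed.

Lemma coords_e k n : e R k n = (n == k)%:R.
Proof. by []. Qed.

(** The span of the basis consists of the finitely supported vectors. *)
Lemma e_spanP x : e_span x <-> exists N, forall n, (N <= n)%N -> x n = 0.
Proof.
split=> [[N [c ->]]|[N xN]].
  exists N => n Nn; rewrite coords_sum big1// => k _.
  by rewrite coordsZ coords_e gtn_eqF ?mulr0// (leq_trans (ltn_ord k)).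
exists N, (fun k => x k); apply: ell2P => n; rewrite coords_sum.
have [Nn|nN] := leqP N n.
  rewrite xN// big1// => k _.
  by rewrite coordsZ coords_e gtn_eqF ?mulr0// (leq_trans (ltn_ord k)).
rewrite (bigD1 (Ordinal nN))// coordsZ coords_e eqxx mulr1 big1 ?Monoid.mulm1// => k.
by rewrite coordsZ coords_e eq_sym -val_eqE => /negbTE->; rewrite mulr0.
Qed.

Lemma e_span_e n : e_span (e R n).
Proof. by apply/e_spanP; exists n.+1 => k nk; rewrite coords_e gtn_eqF. Qed.

(** The inner product with a basis vector is a limit of partial sums that are
    eventually constant. *)
Lemma inner_e j x : inner (e R j) x = x j.
Proof.
have cst N : (j < N)%N -> \sum_(0 <= k < N) conjc (e R j k) * x k = x j.
  move=> jN; rewrite big_mkord (bigD1 (Ordinal jN))// coords_e eqxx rmorph1 mul1r.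
  rewrite big1 ?Monoid.mulm1// => k.
  by rewrite coords_e -val_eqE => /negbTE->; rewrite rmorph0 mul0r.
apply: (@lim_near_cst (R[i]^o : ptopologicalType)).
  exact: (@norm_hausdorff R[i] R[i]^o).
by exists j.+1 => // N; exact: cst.
Qed.

Lemma op_sum (T : operator R) N (c : 'I_N -> R[i]) :
  (@e_span R `<=` dom T)%classic ->
  T (\sum_(k < N) c k *: e R k) = \sum_(k < N) c k *: T (e R k).
Proof.
move=> spT; suff [] : dom T (\sum_(k < N) c k *: e R k) /\
    T (\sum_(k < N) c k *: e R k) = \sum_(k < N) c k *: T (e R k) by [].
elim/big_rec2: _ => [|k y x _ [dx E]].
  by rewrite app0; split=> //; exact: dom0.
by split; [apply: domP|rewrite Defs.appP// ?E] => //; apply/spT/e_span_e.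
Qed.

(** The matrix entry is read along the row n rather than along the column q, so
    that it extends linearly to [tridiagonal_coord]. *)
Lemma tridiagonal_e (T : operator R) (l d u : nat -> R) q n :
  tridiagonal T l d u ->
  T (e R q) n = (u n)%:C * e R q n.+1 + (d n)%:C * e R q n
                + (if n is n'.+1 then (l n')%:C * e R q n' else 0).
Proof.
move=> [_ T0 TS].
have E (f : nat -> R) (p k : nat) :
    (f p)%:C * (p == k)%:R = (f k)%:C * (p == k)%:R :> R[i].
  by case: eqP => [->|_]; rewrite ?mulr0.
have EL : (if n is n'.+1 then (l n')%:C * e R q n' else 0) =
    (l q)%:C * (n == q.+1)%:R.
  by case: n => [|n]; rewrite ?mulr0// coords_e eqSS (E l n).
rewrite EL; case: q {EL} => [|q]; rewrite ?T0 ?TS// !coordsD !coordsZ !coords_e.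
  by rewrite mulr0 add0r (E d n).
by rewrite /= eqSS (E u n) (E d n).
Qed.

Lemma tridiagonal_coord (T : operator R) (l d u : nat -> R) x n :
  tridiagonal T l d u -> e_span x ->
  T x n = (u n)%:C * x n.+1 + (d n)%:C * x n
          + (if n is n'.+1 then (l n')%:C * x n' else 0).
Proof.
move=> hT [N [c ->]].
rewrite op_sum; last by case: hT.
have E k : (\sum_(q < N) c q *: e R q) k = \sum_(q < N) c q * e R q k.
  by rewrite coords_sum.
have -> : (if n is n'.+1 then (l n')%:C * (\sum_(q < N) c q *: e R q) n' else 0)
   = \sum_(q < N) c q * (if n is n'.+1 then (l n')%:C * e R q n' else 0).
  case: n => [|n]; first by rewrite big1// => q _; rewrite mulr0.
  by rewrite E mulr_sumr; apply: eq_bigr => q _; rewrite mulrCA.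
rewrite coords_sum !E !mulr_sumr -!big_split; apply: eq_bigr => q _.
by rewrite coordsZ (tridiagonal_e _ _ _ _ _ _ hT) !mulrDr; congr (_ + _ + _); rewrite mulrCA.
Qed.

Lemma tridiagonal_span (T : operator R) (l d u : nat -> R) x :
  tridiagonal T l d u -> e_span x -> e_span (T x).
Proof.
move=> hT sx; have /e_spanP[N xN] := sx; apply/e_spanP; exists N.+1 => -[//|n] Nn.
by rewrite (tridiagonal_coord _ _ _ _ _ _ hT)// !xN ?mulr0 ?addr0// leqW// leqW.
Qed.

Lemma op_pow_span (T : operator R) (l d u : nat -> R) m x :
  tridiagonal T l d u -> e_span x ->
  dom (op_pow T m) x /\ e_span (op_pow T m x).
Proof.
move=> hT sx; elim: m => [//|m [dm sm]]; split; last exact: tridiagonal_span hT sm.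
by split=> //; case: hT => spT _ _; exact: spT.
Qed.

(** For j < i the paths run upwards from j to i, and the product of the u's
    accounts for the descent from i to j. *)
Lemma op_pow_coord (T : operator R) (l d u : nat -> R) m i j :
  tridiagonal T l d u ->
  op_pow T m (e R i) j =
  (if (i <= j)%N
   then (\prod_(i <= k < j) l k) * path_weight (lambda l u) d m i j
   else (\prod_(j <= k < i) u k) * path_weight (lambda l u) d m j i)%:C.
Proof.
move=> hT; elim: m j => [|m IH] j.
  rewrite [LHS](coords_e i j) /= eq_sym.
  by case: ltngtP => [ij|ji|<-]; rewrite ?mulr0// big_geq// mul1r.
have [_ sm] := op_pow_span T l d u m (e R i) hT (e_span_e i).
rewrite [LHS](tridiagonal_coord _ _ _ _ _ _ hT sm) !IH.
case: (ltngtP i j) => [ij|ji|<-{j}].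
- case: j ij => // j; rewrite ltnS => ij.
  rewrite IH path_weight_last /lambda /= (leqW (leqW ij)) ij.
  rewrite -!rmorphM -!rmorphD.
  rewrite (big_nat_recr j.+1 i)/= ?leqW// (big_nat_recr j i)//=; congr _%:C; ring.
(* The two cases of the induction hypothesis agree at the level i itself. *)
- have -> : (if (i <= j.+1)%N
    then (\prod_(i <= k < j.+1) l k) * path_weight (lambda l u) d m i j.+1
    else (\prod_(j.+1 <= k < i) u k) * path_weight (lambda l u) d m j.+1 i) =
    (\prod_(j.+1 <= k < i) u k) * path_weight (lambda l u) d m j.+1 i.
    have [ij|//] := leqP i j.+1.
    by have -> : i = j.+1; [lia|rewrite !big_geq].
  rewrite path_weight_first.
  case: j ji => [|j] ji.
    rewrite (big_ltn ji) addr0 -!rmorphM -!rmorphD; congr _%:C; ring.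
  rewrite IH leqNgt (ltn_trans _ ji)//= -!rmorphM -!rmorphD.
  rewrite (big_ltn (ltnW ji)) (big_ltn ji) /lambda /=; congr _%:C; ring.
- rewrite leqnSn big_nat1 big_geq// !mul1r path_weight_last.
  case: i IH sm => [|i] IH _.
    by rewrite add0r addr0 -!rmorphM -!rmorphD /lambda /=; congr _%:C; ring.
  (* With i now written i + 1, reversal gives N(i+1, i) = l_i u_i N(i, i+1). *)
  rewrite IH leqNgt ltnSn/= big_nat1 (path_weight_rev _ _ _ _ i i.+1)//.
  rewrite big_nat1 /lambda /=.
  rewrite -!rmorphM -!rmorphD; congr _%:C; ring.
Qed.

Lemma LDU_identically_zero (T : operator R) (l d u : nat -> R) (L D U : operator R) :
  LDU_decomposition T l d u L D U -> identically_zero D -> forall n, d n = 0.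
Proof.
move=> [_ sD _ _ De _ _ _] D0 n.
have := De n; rewrite D0; last exact/sD/e_span_e.
move=> /(congr1 (fun x : ell2 R => x n)); rewrite coordsZ coords_e eqxx mulr1 coords0.
by move=> [].
Qed.

End Coordinates.

(** * Enumeration of Motzkin paths *)

Lemma steps_rcons (s : seq Defs.point) (q : Defs.point) :
  s != [::] -> steps (rcons s q) = rcons (steps s) (last (0, 0) s, q).
Proof.
case: s => // p s _; rewrite /steps /=.
by elim: s p => //= r s IH p; rewrite IH.
Qed.

Lemma weight_rcons (R : realType) (w : Defs.point -> Defs.point -> R)
    (s : seq Defs.point) (q : Defs.point) :
  s != [::] -> weight w (rcons s q) = weight w s * w (last (0, 0) s) q.
Proof. by move=> s0; rewrite /weight steps_rcons// big_rcons. Qed.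

Lemma motzkin_rcons (s : seq Defs.point) (q : Defs.point) :
  s != [::] ->
  motzkin (rcons s q) =
  [&& motzkin s, 0 <= q.2 &
    let p := last (0, 0) s in [|| northeast p q, east p q | southeast p q]].
Proof.
move=> s0; rewrite /motzkin steps_rcons// !all_rcons /=.
by do !case: (all _ _); rewrite ?andbT ?andbF.
Qed.

(** The list of the Motzkin paths of length m from (0, a) to (m, b), by recursion
    on the last step: northeast, east or southeast. *)
Fixpoint motzkin_paths (m a b : nat) : seq (seq Defs.point) :=
  if m is m'.+1 then
    [seq rcons s (m%:Z, b%:Z) |
      s <- (if b is b'.+1 then motzkin_paths m' a b' else [::])
           ++ motzkin_paths m' a b ++ motzkin_paths m' a b.+1]
  else if a == b then [:: [:: (0, a%:Z)]] else [::].

Lemma mem_motzkin_paths (m a b : nat) (s : seq Defs.point) :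
  (s \in motzkin_paths m a b) = motzkin s && joins m a b s.
Proof.
elim: m b s => [|m IH] b s.
  rewrite /= /joins; case: s => [|p [|q s]]; rewrite /= ?andbF;
    try by case: ifP => _; rewrite ?inE ?eqseq_cons ?andbF.
  rewrite /motzkin /= !andbT; case: (eqVneq a b) => [<-|ab].
    by rewrite inE andbb; apply/eqP/andP => [[->]|[_ /eqP->]]//; rewrite eqxx.
  rewrite in_nil; apply/esym/negbTE; apply/negP => /and3P[_ /eqP-> /eqP[]].
  by move/eqP; rewrite (negbTE ab).
case/lastP: s => [|s q]; first by rewrite andbF; apply/mapP => -[[|? ?]].
rewrite /=; apply/mapP/idP => [[r]|].
  move=> rin /rcons_inj[-> ->] {s q}.
  have {rin} [c [cb]] : exists c : nat,
      [|| b == c.+1, b == c | c == b.+1] /\ r \in motzkin_paths m a c.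
    move: rin; rewrite !mem_cat => /or3P[]; last 2 first.
    - by exists b; rewrite eqxx orbT.
    - by exists b.+1; rewrite eqxx !orbT.
    by case: b => // b ?; exists b; rewrite eqxx.
  rewrite IH => /andP[rm /and3P[/eqP sr /eqP hr /eqP lr]].
  have r0 : r != [::] by case: r sr {rm hr lr}.
  have hd q : head (0, 0) (rcons r q) = (0, a%:Z) by case: r r0 hr {rm sr lr}.
  rewrite motzkin_rcons// rm /joins size_rcons sr last_rcons hd !eqxx andbT andTb.
  rewrite lr /northeast /east /southeast /eq_op /=; lia.
have [->|s0] := eqVneq s [::]; first by rewrite /joins andbF.
rewrite motzkin_rcons// /joins size_rcons last_rcons.
move=> /andP[/and3P[sm q2 st]] /and3P[/eqP[ss] hs /eqP qE].
exists s; last by rewrite qE.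
have sE : s = rcons (belast (head (0, 0) s) (behead s)) (last (0, 0) s).
  by case: s s0 {sm st ss hs} => //= p s _; rewrite -lastI.
have p2 : 0 <= (last (0, 0) s).2.
  by move: sm; rewrite {1}sE /motzkin all_rcons => /andP[/andP[]].
(* A path from level a whose last point is (m, c) is in the list by induction;
   the last step leaves three possible values of c. *)
have J c : last (0, 0) s = (m%:Z, c%:Z) -> s \in motzkin_paths m a c.
  move=> lE; rewrite IH sm /joins ss lE !eqxx andbT /=.
  by case: s s0 hs {sE p2 sm st ss lE}.
move: st p2 J; rewrite qE; case: (last (0, 0) s) => x y /=.
rewrite /northeast /east /southeast /eq_op/= !mem_cat.
move=> st y0 J.
have xm : x = m%:Z by lia.
have [|[|]] : (0 < b)%N /\ y = b.-1%:Z \/ y = b%:Z \/ y = b.+1%:Z by lia.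
- by case: b {qE st} J => [|b] J [// _ yb]; rewrite J// xm yb.
- by move=> yb; rewrite (J b) ?orbT// xm yb.
- by move=> yb; rewrite (J b.+1) ?orbT// xm yb.
Qed.

Lemma motzkin_paths_last (m a b : nat) (s : seq Defs.point) :
  s \in motzkin_paths m a b -> last (0, 0) s = (m%:Z, b%:Z).
Proof. by rewrite mem_motzkin_paths => /andP[_ /and3P[_ _ /eqP]]. Qed.

Lemma motzkin_paths_neq0 (m a b : nat) (s : seq Defs.point) :
  s \in motzkin_paths m a b -> s != [::].
Proof. by rewrite mem_motzkin_paths => /andP[_ /and3P[]]; case: s. Qed.

Lemma uniq_motzkin_paths (m a b : nat) : uniq (motzkin_paths m a b).
Proof.
elim: m b => [|m IH] b /=; first by case: eqP.
rewrite map_inj_uniq; last exact: rcons_injl.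
have disj c d : c != d ->
    ~~ has (mem (motzkin_paths m a c)) (motzkin_paths m a d).
  move=> cd; apply/hasPn => s /motzkin_paths_last sd; apply/negP.
  by move=> /motzkin_paths_last; rewrite sd => -[] /eqP; rewrite eq_sym (negbTE cd).
rewrite !cat_uniq !IH has_cat negb_or !disj ?ltn_eqF//.
case: b => [|b]; last by rewrite IH !disj// ?ltn_eqF.
by rewrite /= !andbT; do ?[apply/andP; split]; apply/hasPn.
Qed.

Lemma motzkin_totalE (R : realType) (l d u : nat -> R) (m a b : nat) :
  motzkin_total l d u m a b = path_weight (lambda l u) d m a b.
Proof.
rewrite /motzkin_total.
have -> : [set s | motzkin s && joins m a b s]%classic =
    [set` motzkin_paths m a b]%classic.
  by apply/seteqP; split => s /=; rewrite mem_motzkin_paths.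
rewrite -(fsbig_seq _ _ (uniq_motzkin_paths m a b)).
set w := motzkin_step_weight l d u.
elim: m b => [|m IH] b.
  rewrite /=; case: eqP => _; last by rewrite big_nil.
  by rewrite big_seq1 /weight big_nil.
have E c : \sum_(s <- motzkin_paths m a c) weight w (rcons s (m.+1%:Z, b%:Z)) =
    path_weight (lambda l u) d m a c * w (m%:Z, c%:Z) (m.+1%:Z, b%:Z).
  rewrite -IH mulr_suml [LHS]big_seq [RHS]big_seq; apply: eq_bigr => s sin.
  rewrite weight_rcons ?(motzkin_paths_neq0 _ _ _ _ sin)//.
  by rewrite (motzkin_paths_last _ _ _ _ sin).
rewrite path_weight_last [motzkin_paths _ _ _]/= big_map !big_cat/= !E addrA.
congr (_ + _ * _ + _ * _).
- case: b E => [|b] E; first by rewrite big_nil.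
  rewrite E /w /motzkin_step_weight /northeast /eq_op /=.
  by rewrite ifT ?mulr1//; lia.
- rewrite /w /motzkin_step_weight /northeast /east /eq_op /=.
  by rewrite ifF; [rewrite ifT//|]; lia.
- rewrite /w /motzkin_step_weight /northeast /east /eq_op /=.
  by rewrite ifF; [rewrite ifF//|]; lia.
Qed.

Lemma motzkin_total_dyck (R : realType) (l d u : nat -> R) (m a b : nat) :
  (forall n, d n = 0) -> motzkin_total l d u m a b = dyck_total l u m a b.
Proof.
move=> d0; rewrite /dyck_total /motzkin_total.
(* The two step weights differ on east steps, so the weights of Dyck paths are
   compared before the range of the sum is enlarged to all Motzkin paths. *)
transitivity (\sum_(s \in [set s | dyck s && joins m a b s]%classic)
    weight (motzkin_step_weight l d u) s); last first.
  apply: eq_fsbigr => s; rewrite inE /= => /andP[/andP[_ /allP noE] _].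
  rewrite /weight [LHS]big_seq [RHS]big_seq; apply: eq_bigr => st /noE.
  by rewrite /motzkin_step_weight /dyck_step_weight => /negbTE->.
apply/esym/fsbig_widen => s /=; first by rewrite /dyck -andbA => /and3P[-> _ ->].
move=> [/andP[sm sj]]; rewrite /dyck sm sj andbT /= => /negP.
rewrite -has_predC => /hasP[st stin /=]; rewrite negbK => stE.
rewrite /weight (big_rem st)//= /motzkin_step_weight stE.
rewrite (_ : northeast _ _ = false) ?d0 ?mul0r//.
move: stE; rewrite /east /northeast => /eqP->; rewrite /eq_op /=; lia.
Qed.

Theorem theorem2p5 (R : realType) (i : nat) (d : int) (hd : - i%:Z <= d)
    (T : operator R) (l dg u : nat -> R) (hT : tridiagonal T l dg u)
    (L D U : operator R) (hLDU : LDU_decomposition T l dg u L D U) (m : nat) :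
  let j := absz (i%:Z + d) in
  dom (op_pow T m) (e R i) /\
  (d = 0 ->
     inner (e R j) (op_pow T m (e R i)) = (motzkin_total l dg u m i j)%:C) /\
  (0 < d ->
     inner (e R j) (op_pow T m (e R i)) =
     ((\prod_(i <= k < j) l k) * motzkin_total l dg u m i j)%:C) /\
  (* For d < 0 the endpoints are exchanged: with paths from level i to level j
     the formula fails, e.g. for i = m = 1, d = -1, u 0 = 1, l 0 = 2. *)
  (d < 0 ->
     inner (e R j) (op_pow T m (e R i)) =
     ((\prod_(j <= k < i) u k) * motzkin_total l dg u m j i)%:C) /\
  (identically_zero D ->
     motzkin_total l dg u m i j = dyck_total l u m i j /\
     motzkin_total l dg u m j i = dyck_total l u m j i).
Proof.
move=> j.
have jE : j%:Z = i%:Z + d by rewrite /j; lia.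
rewrite inner_e (op_pow_coord _ _ _ _ _ _ _ hT) !motzkin_totalE.
split; first by have [] := op_pow_span _ _ _ _ m _ hT (e_span_e i).
split=> [d0|].
  by have -> : j = i; [lia|rewrite leqnn big_geq// mul1r].
split=> [d_gt0|].
  by rewrite ifT//; lia.
split=> [d_lt0|D0].
  by rewrite ifF//; lia.
by rewrite -!motzkin_totalE; split; apply: motzkin_total_dyck;
  exact: LDU_identically_zero hLDU D0.
Qed.
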